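(* Let $A\in\mathrm{GL}_n(\mathfrak{W}_{\mathbb{Q}})$ be upper triangular with scalar Wiener indices $q_1\le q_2\le\cdots\le q_n\in\mathbb{Q}$ on the diagonal (i.e. the $j$-th diagonal entry $a_{jj}$ has Wiener index $q_j$). Then there exist $$A_-\in\mathrm{GL}_n(\mathfrak{W}^-_{\mathbb{Q}}),\qquad A_+\in\mathrm{GL}_n(\mathfrak{W}^+_{\mathbb{Q}})$$ such that $$A=A_-\,\operatorname{diag}(\chi_{q_1},\ldots,\chi_{q_n})\,A_+ .$$ Dually, a lower-triangular matrix $A\in\mathrm{GL}_n(\mathfrak{W}_{\mathbb{Q}})$ whose diagonal entries have scalar Wiener indices satisfying $q_1\ge\cdots\ge q_n$ admits an analogous factorization $A=A_-\,\operatorname{diag}(\chi_{q_1},\ldots,\chi_{q_n})\,A_+$ with $A_\pm\in\mathrm{GL}_n(\mathfrak{W}^\pm_{\mathbb{Q}})$.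
   Context: The universal solenoid is $S^1_{\mathbb{Q}}=\varprojlim S^1$ over positive integers ordered by divisibility, with bonding maps $z\mapsto z^{m/n}$ for $n\mid m$; it is a compact connected abelian group with Pontryagin dual the discrete group $\mathbb{Q}$. For $q=k/N\in\mathbb{Q}$ the corresponding character is $\chi_q(\mathbf{u})=\pi_N(\mathbf{u})^k$, where $\pi_N:S^1_{\mathbb{Q}}\to S^1$ is the projection to level $N$. The rational Wiener algebra $\mathfrak{W}_{\mathbb{Q}}$ is the Banach algebra of functions $f=\sum_{q\in\mathbb{Q}}a_q\chi_q:S^1_{\mathbb{Q}}\to\mathbb{C}$ with $\|f\|=\sum_{q\in\mathbb{Q}}|a_q|<\infty$, under pointwise multiplication. $\mathfrak{W}^+_{\mathbb{Q}}$ (resp. $\mathfrak{W}^-_{\mathbb{Q}}$) is the closed subalgebra of those $f$ with $a_q=0$ for $q<0$ (resp. for $q>0$). The scalar Wiener index of a unit $f\in\mathfrak{W}_{\mathbb{Q}}$ is the unique $q\in\mathbb{Q}$ for which $f=f_-\chi_qf_+$ with $f_\pm$ units of $\mathfrak{W}^\pm_{\mathbb{Q}}$ (such a factorization always exists); equivalently it is the winding number of $f$, i.e. the unique $q$ such that $f/|f|:S^1_{\mathbb{Q}}\to S^1$ is homotopic to $\chi_q$. *)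

(* Defs.v *)
From HB Require Import structures.
From mathcomp Require Import all_boot all_order all_algebra.
From mathcomp Require Import finmap.
From mathcomp Require Import complex.
From mathcomp Require Import all_classical reals constructive_ereal ereal topology normedtype esum.
From mathcomp Require Import showcase.summability.

Set Implicit Arguments.
Unset Strict Implicit.
Unset Printing Implicit Defensive.
Import Order.TTheory GRing.Theory Num.Theory.

Local Open Scope classical_set_scope.
Local Open Scope ring_scope.

Definition level := {N : nat | (0 < N)%N}.

(* The points of the inverse limit of circles |z| = 1 over the positive integers
   ordered by divisibility, with bonding map z |-> z ^ (M / N) for N | M. *)
Record solenoid (R : realType) := Solenoid {
  sproj : level -> R[i];
  sproj_circle : forall N : level, `|sproj N| = 1;
  sproj_bond : forall N M : level, (val N %| val M)%N ->
    sproj N = sproj M ^+ (val M %/ val N)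
}.

Lemma absz_denq_gt0 (q : rat) : (0 < `|denq q|)%N.
Proof. by rewrite absz_gt0 denq_neq0. Qed.

Definition den_level (q : rat) : level :=
  exist _ `|denq q|%N (absz_denq_gt0 q).

(* The fraction is taken in lowest terms; by [chi_frac] below any other
   representation k / N gives the same value. *)
Definition chi (R : realType) (q : rat) (u : solenoid R) : R[i] :=
  sproj u (den_level q) ^ numq q.

Lemma chi_frac (R : realType) (k : int) (N : level) (u : solenoid R) :
  chi (k%:Q / (val N)%:Q) u = sproj u N ^ k.
Proof.
set q : rat := k%:Q / (val N)%:Q.
have N0 : (val N)%:Z != 0 by rewrite eqz_nat -lt0n; exact: (valP N).
have NQ0 : (val N)%:Q != 0 :> rat by rewrite intr_eq0.
have e : k * denq q = numq q * (val N)%:Z.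
  apply: (@intr_inj rat); rewrite !intrM numqE.
  by rewrite mulrAC /q divfK.
have dvd : (`|denq q| %| val N)%N.
  have := coprime_num_den q; rewrite coprime_sym => cop.
  have : (`|denq q| %| `|numq q| * val N)%N.
    by rewrite -[X in (_ * X)%N](absz_nat (val N)) -abszM -e abszM dvdn_mull.
  by rewrite Gauss_dvdr.
have := sproj_bond u (N := den_level q) (M := N) dvd.
rewrite /chi => ->.
rewrite exprnP exprz_exp; congr (_ ^ _).
have d0 : denq q != 0 := denq_neq0 q.
apply: (mulIf d0); rewrite e mulrAC mulrC; congr (_ * _).
have dE : denq q = `|denq q|%N by rewrite gez0_abs ?ltW.
by rewrite [X in _ * X]dE -PoszM divnK.
Qed.

(* The functions f = \sum_q a_q chi_q with \sum_q |a_q| finite and a_q = 0 for q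
   outside D; the series over rat is an unordered sum, i.e. a limit along the
   net of finite subsets of rat. [normc] is the R-valued modulus. *)
Definition wiener_on (R : realType) (D : set rat) : set (solenoid R -> R[i]) :=
  [set f : solenoid R -> R[i] | exists a : rat -> R[i],
    [/\ (\esum_(q in [set: rat]) (ComplexField.Normc.normc (a q))%:E < +oo)%E,
        forall q, ~ D q -> a q = 0
      & forall u : solenoid R,
          partial_sum (fun q => a q * chi q u : R[i]^o) @ totally --> (f u : R[i]^o)]].

Definition wiener (R : realType) := @wiener_on R setT.
Definition wiener_minus (R : realType) := @wiener_on R [set q | q <= 0].
Definition wiener_plus (R : realType) := @wiener_on R [set q | 0 <= q].

(* The Wiener algebras are kept as sets of functions, inside the ring of all
   functions on the solenoid with pointwise operations: [unit_of W] and [GL_of W]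
   require the inverse to lie in W as well. *)
Definition unit_of (K : pzRingType) (W : set K) : set K :=
  [set f | W f /\ exists g, [/\ W g, f * g = 1 & g * f = 1]].

Definition GL_of (K : pzRingType) (W : set K) (n : nat) : set 'M[K]_n :=
  [set A : 'M[K]_n | (forall i j, W (A i j)) /\
    exists B : 'M[K]_n,
      [/\ forall i j, W (B i j), A *m B = 1%:M & B *m A = 1%:M]].

(* The index being unique, it is rendered as a relation between f and q. *)
Definition has_wiener_index (R : realType) (f : solenoid R -> R[i]) (q : rat) :=
  exists fm fp : solenoid R -> R[i],
    [/\ unit_of (@wiener_minus R) fm, unit_of (@wiener_plus R) fp
      & f = fm * @chi R q * fp].

Definition diag_factorization (R : realType) (n : nat)
    (A : 'M[solenoid R -> R[i]]_n) (q : 'I_n -> rat) :=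
  exists Am Ap : 'M[solenoid R -> R[i]]_n,
    [/\ GL_of (@wiener_minus R) Am, GL_of (@wiener_plus R) Ap
      & A = Am *m diag_mx (\row_j @chi R (q j)) *m Ap].

(* Main.v *)
Require Import Defs.
From mathcomp Require Import all_boot all_order all_algebra finmap.
From mathcomp Require Import complex.
From mathcomp Require Import all_classical reals ereal topology normedtype esum.
From mathcomp Require Import showcase.summability.
Set Implicit Arguments.
Unset Strict Implicit.
Unset Printing Implicit Defensive.
Import Order.TTheory GRing.Theory Num.Theory numFieldNormedType.Exports.
Local Open Scope classical_set_scope.
Local Open Scope ring_scope.

(** Triangular factorization rests on one additive splitting.  If p <= q, every
f in the Wiener algebra is chi_p x + y chi_q with x in the plus algebra and y in
the minus algebra ([wiener_split]): cut the series of f at frequency p, divide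
the part of frequencies >= p by chi_p, and divide the part of frequencies
< p <= q by chi_q.

Given this, an upper triangular matrix is factored by induction on its size
([upper_factorization]).  Write A in blocks with first diagonal entry
fm d fp, first row remainder r, and lower right block A' = L D P factored by
induction.  One looks for
  A = (fm, fm Y; 0, L) (d, 0; 0, D) (fp, X P; 0, P),
and the only equation left is fm d X P + fm Y D P = r, that is,
d X + Y D = r / fm * P^-1.  It is solved entry by entry by the splitting, and
it is here that the increasing order of the indices is needed.  Block
triangular matrices with invertible diagonal blocks are invertible over the
same algebra, so both outer factors are as required.  This part works in any
commutative ring.  In this form the argument is symmetric in the plus and minus
algebras, so the lower triangular case follows by transposition
([lower_factorization]).

The analytic input is that absolutely convergent series of characters form a
ring ([wiener_onM]).  A product of two such series is summed over rat * rat and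
regrouped along the fibers of (p, q) |-> p + q; [sums_to_fiberwise] and
[abs_summable_fiberwise] say that regrouping preserves the sum and absolute
summability. *)

(** * Factorization of triangular matrices over a commutative ring *)

Section TriangularFactorization.
Context {K : comPzRingType}.
Implicit Types W : set K.

Definition subring_set W :=
  [/\ W 1, forall x y, W x -> W y -> W (x - y)
    & forall x y, W x -> W y -> W (x * y)].

Definition entries_in W m n (A : 'M[K]_(m, n)) := forall i j, W (A i j).

Section Entries.
Context {W : set K} (hW : subring_set W).

Lemma subring_set0 : W 0.
Proof. by case: hW => h1 hB _; rewrite -(subrr 1); apply: hB. Qed.

Lemma subring_setN x : W x -> W (- x).
Proof.
by case: hW => _ hB _ Wx; rewrite -sub0r; apply: hB => //; exact: subring_set0.
Qed.

Lemma subring_setD x y : W x -> W y -> W (x + y).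
Proof. by case: hW => _ hB _ Wx Wy; rewrite -(opprK y); apply/hB/subring_setN. Qed.

Lemma subring_setM x y : W x -> W y -> W (x * y).
Proof. by case: hW => _ _; apply. Qed.

Lemma entries_in0 m n : entries_in W (0 : 'M_(m, n)).
Proof. by move=> i j; rewrite mxE; exact: subring_set0. Qed.

Lemma entries_inN m n (A : 'M_(m, n)) : entries_in W A -> entries_in W (- A).
Proof. by move=> hA i j; rewrite mxE; exact: subring_setN. Qed.

Lemma entries_inZ m n c (A : 'M_(m, n)) :
  W c -> entries_in W A -> entries_in W (c *: A).
Proof. by move=> hc hA i j; rewrite mxE; exact: subring_setM. Qed.

Lemma entries_in_mul m n p (A : 'M_(m, n)) (B : 'M_(n, p)) :
  entries_in W A -> entries_in W B -> entries_in W (A *m B).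
Proof.
move=> hA hB i j; rewrite mxE.
apply: big_ind => [|x y|k _]; first exact: subring_set0.
  exact: subring_setD.
exact: subring_setM.
Qed.

Lemma entries_in_block m n p q (A : 'M_(m, n)) (B : 'M_(m, p))
    (C : 'M_(q, n)) (D : 'M_(q, p)) :
  entries_in W A -> entries_in W B -> entries_in W C -> entries_in W D ->
  entries_in W (block_mx A B C D).
Proof.
move=> hA hB hC hD i j.
by rewrite !mxE; case: splitP => k _; rewrite mxE; case: splitP => l _.
Qed.

(** The inverse of (A, C; 0, B) is (A', - A' C B'; 0, B'), with A' and B' the
inverses of A and B, so no determinants are involved. *)
Lemma GL_of_block_upper m n (A : 'M_m) (C : 'M_(m, n)) (B : 'M_n) :
  GL_of W A -> entries_in W C -> GL_of W B -> GL_of W (block_mx A C 0 B).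
Proof.
move=> [hA [A' [hA' AA' A'A]]] hC [hB [B' [hB' BB' B'B]]]; split.
  by apply: entries_in_block => //; exact: entries_in0.
exists (block_mx A' (- (A' *m C *m B')) 0 B'); split.
- apply: entries_in_block => //; last exact: entries_in0.
  by apply: entries_inN; do !apply: entries_in_mul.
- rewrite mulmx_block !mulmx0 !mul0mx !addr0 add0r AA' BB' mulmxN !mulmxA AA'.
  by rewrite mul1mx addNr -scalar_mx_block.
- rewrite mulmx_block !mulmx0 !mul0mx !addr0 add0r A'A B'B mulNmx -!mulmxA B'B.
  by rewrite mulmx1 subrr -scalar_mx_block.
Qed.

Lemma GL_of_scalar1 x : unit_of W x -> GL_of W (x%:M : 'M_1).
Proof.
have scal y : W y -> entries_in W (y%:M : 'M_1).
  by move=> Wy i j; rewrite !ord1 mxE.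
move=> [Wx [y [Wy xy yx]]]; split; first exact: scal.
by exists y%:M; split; rewrite -?scalar_mxM ?xy ?yx //; exact: scal.
Qed.

End Entries.

Lemma GL_of_tr W n (A : 'M_n) : GL_of W A -> GL_of W A^T.
Proof.
move=> [hA [B [hB AB BA]]]; split; first by move=> i j; rewrite mxE.
exists B^T; split; first by move=> i j; rewrite mxE.
  by rewrite -trmx_mul BA trmx1.
by rewrite -trmx_mul AB trmx1.
Qed.

Lemma mul_block_upper m n (a c b : 'M[K]_m) (x y : 'M_(m, n)) (L D P : 'M_n) :
  block_mx a x 0 L *m block_mx c 0 0 D *m block_mx b y 0 P =
  block_mx (a *m c *m b) (a *m c *m y + x *m D *m P) 0 (L *m D *m P).
Proof.
by rewrite !mulmx_block !(mulmx0, mul0mx, addr0, add0r).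
Qed.

(** The elements d_j stand for the characters on the diagonal; about them only
the splitting of W by d_i and d_j, for i <= j, is assumed. *)
Lemma upper_factorization W Wm Wp :
    subring_set W -> subring_set Wm -> subring_set Wp ->
    Wm `<=` W -> Wp `<=` W ->
  forall n (A : 'M[K]_n) (d : 'I_n -> K),
    entries_in W A -> is_trig_mx A^T ->
    (forall j, exists fm fp,
      [/\ unit_of Wm fm, unit_of Wp fp & A j j = fm * d j * fp]) ->
    (forall i j : 'I_n, (i <= j)%N -> forall g, W g ->
      exists x y, [/\ Wp x, Wm y & g = d i * x + y * d j]) ->
  exists Am Ap : 'M[K]_n,
    [/\ GL_of Wm Am, GL_of Wp Ap & A = Am *m diag_mx (\row_j d j) *m Ap].
Proof.
move=> hW hWm hWp WmW WpW; elim=> [|n IH] A d WA trigA diagA splitA.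
  exists 1%:M, 1%:M; split; last by apply/matrixP => -[].
    by split=> [[]|] //; exists 1%:M; split; [case|rewrite mulmx1..].
  by split=> [[]|] //; exists 1%:M; split; [case|rewrite mulmx1..].
have lowA (i j : 'I_n.+1) : (i < j)%N -> A j i = 0.
  by move=> ij; move/is_trig_mxP: trigA => /(_ i j ij); rewrite mxE.
pose A' : 'M_n := drsubmx (A : 'M_(1 + n)).
pose r : 'rV_n := ursubmx (A : 'M_(1 + n)).
pose d' j := d (lift ord0 j).
have A'E i j : A' i j = A (lift ord0 i) (lift ord0 j).
  by rewrite !mxE !rshift1.
have [L [P [GL_L GL_P A'LDP]]] : exists L P : 'M_n,
    [/\ GL_of Wm L, GL_of Wp P & A' = L *m diag_mx (\row_j d' j) *m P].
  apply: IH => [i j||j|i j ij g Wg].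
  - by rewrite A'E.
  - by apply/is_trig_mxP => i j ij; rewrite mxE A'E lowA.
  - by rewrite A'E; exact: diagA.
  - exact: splitA.
have [fm [fp [ufm ufp A00]]] := diagA ord0.
have AE : A = block_mx (fm * d ord0 * fp)%:M r 0 A' :> 'M_(1 + n).
  rewrite -[LHS](@submxK _ 1 n 1 n); congr block_mx.
    apply/matrixP => i j; rewrite !ord1 -A00 !mxE eqxx mulr1n.
    by congr (A _ _); apply: val_inj.
  by apply/matrixP => i j; rewrite !mxE !ord1 lowA.
have [Wfm [fm' [Wfm' fmfm' _]]] := ufm.
have [WP [P' [WP' _ P'P]]] := GL_P.
(* r divided by fm on the left and by P on the right; it remains to split it
   as d_0 X + Y D *)
pose g : 'rV_n := fm' *: r *m P'.
have Wg : entries_in W g.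
  apply: entries_in_mul => //; last by move=> i j; exact/WpW.
  apply: entries_inZ => //; first exact: WmW.
  by move=> i j; rewrite !mxE.
have /choice[x /choice[y xyP]] j : exists x y,
    [/\ Wp x, Wm y & g 0 j = d ord0 * x + y * d' j].
  exact: splitA.
pose X : 'rV_n := \row_j x j; pose Y : 'rV_n := \row_j y j.
have gE : g = d ord0 *: X + Y *m diag_mx (\row_j d' j).
  apply/rowP => j; have [_ _ ->] := xyP j.
  by rewrite mul_mx_diag !mxE.
have rE : r = (fm * d ord0) *: (X *m P) + fm *: (Y *m diag_mx (\row_j d' j) *m P).
  have -> : r = fm *: (g *m P).
    by rewrite /g -mulmxA P'P mulmx1 scalerA fmfm' scale1r.
  by rewrite gE mulmxDl scalerDr -scalemxAl scalerA.
exists (block_mx fm%:M (fm *: Y) 0 L), (block_mx fp%:M (X *m P) 0 P); split.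
- apply: (GL_of_block_upper _ (m := 1)) => //; first exact: GL_of_scalar1.
  by apply: entries_inZ => // i j; rewrite mxE; have [] := xyP j.
- apply: (GL_of_block_upper _ (m := 1)) => //; first exact: GL_of_scalar1.
  by apply: entries_in_mul => // i j; rewrite mxE; have [] := xyP j.
have -> : diag_mx (\row_j d j) =
    block_mx (d ord0)%:M 0 0 (diag_mx (\row_j d' j)) :> 'M_(1 + n).
  have -> : \row_j d j = row_mx (d ord0)%:M (\row_j d' j) :> 'rV_(1 + n).
    apply/rowP => j; rewrite !mxE; case: splitP => k kE; rewrite !mxE.
      by rewrite !ord1 mulr1n; congr d; apply: val_inj; rewrite /= kE ord1.
    by rewrite /d'; congr d; apply: val_inj.
  apply: etrans (diag_mx_row _ _) _; congr block_mx.
  by apply/matrixP => i j; rewrite !mxE !ord1.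
apply: etrans AE (esym _).
have -> : (fm * d ord0 * fp)%:M = fm%:M *m (d ord0)%:M *m fp%:M :> 'M[K]_1.
  by rewrite -!scalar_mxM.
rewrite rE A'LDP -[_ *: (X *m P)]mul_scalar_mx scalar_mxM !scalemxAl.
exact: (@mul_block_upper 1 n fm%:M (d ord0)%:M fp%:M (fm *: Y) (X *m P) L
  (diag_mx (\row_j d' j)) P).
Qed.

(** The transpose of A is upper triangular, and transposing a product exchanges
its outer factors.  Applying the upper triangular case with Wm and Wp exchanged
therefore puts each factor back on its side. *)
Lemma lower_factorization W Wm Wp :
    subring_set W -> subring_set Wm -> subring_set Wp ->
    Wm `<=` W -> Wp `<=` W ->
  forall n (A : 'M[K]_n) (d : 'I_n -> K),
    entries_in W A -> is_trig_mx A ->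
    (forall j, exists fm fp,
      [/\ unit_of Wm fm, unit_of Wp fp & A j j = fm * d j * fp]) ->
    (forall i j : 'I_n, (i <= j)%N -> forall g, W g ->
      exists x y, [/\ Wp x, Wm y & g = d j * x + y * d i]) ->
  exists Am Ap : 'M[K]_n,
    [/\ GL_of Wm Am, GL_of Wp Ap & A = Am *m diag_mx (\row_j d j) *m Ap].
Proof.
move=> hW hWm hWp WmW WpW n A d WA trigA diagA splitA.
have [||||B [C [GLB GLC E]]] := upper_factorization hW hWp hWm WpW WmW
  (A := A^T) (d := d).
- by move=> i j; rewrite mxE.
- by rewrite trmxK.
- move=> j; have [fm [fp [ufm ufp Ajj]]] := diagA j.
  by exists fp, fm; rewrite mxE Ajj mulrC [fm * _]mulrC mulrA.
- move=> i j ij g /(splitA i j ij)[x [y [px my ->]]].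
  by exists y, x; split=> //; rewrite addrC mulrC [x * _]mulrC.
exists C^T, B^T; split; [exact: GL_of_tr..|].
by rewrite -[A]trmxK E !trmx_mul tr_diag_mx mulmxA.
Qed.

End TriangularFactorization.

(** * Unordered sums *)

#[local] Existing Instance totally_filter.

Lemma partial_sumE (T : choiceType) (V : zmodType) (z : T -> V) (F : {fset T}) :
  partial_sum z F = \sum_(i <- F) z i.
Proof. by rewrite big_seq_fsetE. Qed.

Lemma sumr_fset_pred1 (T : choiceType) (V : nmodType) (F : {fset T}) p (c : V) :
  \sum_(i <- F | i == p) c = if p \in F then c else 0.
Proof.
case: ifPn => pF; first by rewrite -big_filter filter_pred1_uniq ?big_seq1.
by rewrite big_seq_cond big1// => i /andP[iF /eqP ip]; rewrite -ip iF in pF.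
Qed.

Lemma totally_superset (T : choiceType) (F : {fset T}) :
  \forall G \near totally, (F `<=` G)%fset.
Proof. by exists F. Qed.

Definition sums_to (K : numFieldType) (T : choiceType) (z : T -> K) (s : K) :=
  partial_sum (z : T -> K^o) @ totally --> (s : K^o).

Section UnorderedSums.
Context {K : numFieldType}.

Lemma sums_to_unique (T : choiceType) (z : T -> K) s t :
  sums_to z s -> sums_to z t -> s = t.
Proof.
move=> zs zt; apply: (cvg_unique _ zs zt).
exact: (@norm_hausdorff K K^o).
Qed.

Lemma sums_toB (T : choiceType) (z w : T -> K) s t :
  sums_to z s -> sums_to w t -> sums_to (fun i => z i - w i) (s - t).
Proof.
move=> zs wt; rewrite /sums_to (_ : partial_sum _ =
    fun F => partial_sum (z : T -> K^o) F - partial_sum (w : T -> K^o) F).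
  exact: cvgB.
by apply/funext => F; rewrite !partial_sumE sumrB.
Qed.

Lemma sums_toMl (T : choiceType) (z : T -> K) c s :
  sums_to z s -> sums_to (fun i => c * z i) (c * s).
Proof.
move=> zs; rewrite /sums_to (_ : partial_sum _ =
    fun F => c * partial_sum (z : T -> K^o) F).
  exact: cvgMl_tmp.
by apply/funext => F; rewrite !partial_sumE mulr_sumr.
Qed.

Lemma sums_toMr (T : choiceType) (z : T -> K) c s :
  sums_to z s -> sums_to (fun i => z i * c) (s * c).
Proof.
move=> /(@sums_toMl _ _ c); rewrite mulrC; congr sums_to.
by apply/funext => i; rewrite mulrC.
Qed.

Lemma sums_to0 (T : choiceType) : sums_to (fun _ : T => 0 : K) 0.
Proof.
rewrite /sums_to (_ : partial_sum _ = cst 0); first exact: cvg_cst.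
by apply/funext => F; rewrite partial_sumE big1.
Qed.

Lemma sums_to_single (T : choiceType) (p : T) (c : K) :
  sums_to (fun i => if i == p then c else 0) c.
Proof.
apply: cvg_near_cst; apply: filterS (totally_superset [fset p]%fset) => F.
rewrite fsub1set => pF; rewrite partial_sumE -big_mkcond /=.
by rewrite sumr_fset_pred1 pF.
Qed.

(** A finite partial sum of t over G is the limit over H of the sums of z over
those k in H with f k in G.  As soon as G contains the image of a set F beyond
which partial sums of z are close to s, and H contains F, such a set also
contains F. *)
Lemma sums_to_fiberwise (S T : choiceType) (f : S -> T) (z : S -> K) s t :
  sums_to z s ->
  (forall i, sums_to (fun k => if f k == i then z k else 0) (t i)) ->
  sums_to t s.
Proof.
move=> zs zt; apply/cvgrPdist_lt => e e0.
have e20 : 0 < e / 2 by rewrite divr_gt0.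
move/cvgrPdist_lt: zs => /(_ _ e20)[F _ sF].
apply: filterS (totally_superset (f @` F)%fset) => G FG.
have tG : (fun H : {fset S} =>
    \sum_(i <- G) \sum_(k <- H) (if f k == i then z k else 0)) @ totally -->
    (\sum_(i <- G) t i : K^o).
  apply: (@cvg_big K^o _ _ _ _ (@add_continuous K^o)) => i _.
  by have := zt i; rewrite /sums_to; under eq_cvg do rewrite partial_sumE.
move/cvgrPdist_lt: tG => /(_ _ e20) tG.
have [H [FH HG]] := filter_ex (filterI (totally_superset F) tG).
pose H' := [fset k in H | f k \in G]%fset.
have FH' : (F `<=` H')%fset.
  apply/fsubsetP => k kF; rewrite !inE (fsubsetP FH)//=.
  by apply/(fsubsetP FG)/imfsetP; exists k.
have sumE : \sum_(i <- G) \sum_(k <- H) (if f k == i then z k else 0) =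
    partial_sum (z : S -> K^o) H'.
  rewrite partial_sumE big_fset /= exchange_big /= [RHS]big_mkcond /=.
  apply: eq_bigr => k _; rewrite -big_mkcond /=.
  by under eq_bigl do rewrite eq_sym; exact: sumr_fset_pred1.
rewrite [e]splitr -[s](subrK (partial_sum (z : S -> K^o) H')) -addrA.
apply: le_lt_trans (ler_normD _ _) _; rewrite ltrD//; first exact: sF.
by rewrite distrC partial_sumE -sumE.
Qed.

Lemma sums_to_fst (S T : choiceType) (p : S) (w : T -> K) s :
  sums_to w s -> sums_to (fun k : S * T => if k.1 == p then w k.2 else 0) s.
Proof.
move=> ws; apply/cvgrPdist_lt => e e0.
move/cvgrPdist_lt: ws => /(_ _ e0)[F _ sF].
apply: filterS (totally_superset [fset (p, q) | q in F]%fset) => G FG.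
pose G' := [fset k in G | k.1 == p]%fset.
rewrite partial_sumE -big_mkcond /=.
have -> : \sum_(k <- G | k.1 == p) w k.2 = partial_sum (w : T -> K^o) (snd @` G')%fset.
  rewrite partial_sumE big_imfset /= ?big_fset //= => -[a1 a2] [b1 b2].
  by rewrite !inE /= => /andP[_ /eqP->] /andP[_ /eqP->] ->.
apply: sF => /=; apply/fsubsetP => q qF; apply/imfsetP; exists (p, q) => //=.
by rewrite !inE /= eqxx andbT (fsubsetP FG)//; apply/imfsetP; exists q.
Qed.

(** Regrouping the double series along the first projection yields the series of
a p * t, whose sum is s * t; uniqueness of sums concludes. *)
Lemma sums_to_mul (S T : choiceType) (a : S -> K) (b : T -> K) s t u :
  sums_to a s -> sums_to b t ->
  sums_to (fun k : S * T => a k.1 * b k.2) u -> u = s * t.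
Proof.
move=> sa tb sab.
apply: (@sums_to_unique _ (fun p => a p * t)); last exact: sums_toMr.
apply: (sums_to_fiberwise (f := fst)) sab _ => p.
have := sums_to_fst p (sums_toMl (c := a p) tb); congr sums_to.
by apply/funext => -[x y] /=; case: eqP => // ->.
Qed.

End UnorderedSums.

(** * Absolutely summable complex families *)

Section AbsoluteSums.
Context {R : realType}.
Implicit Types T S : choiceType.
Local Notation normc := (@ComplexField.Normc.normc R).
Local Open Scope complex_scope.

Lemma normc_ge0 (z : R[i]) : 0 <= normc z.
Proof. by case: z => a b; exact: sqrtr_ge0. Qed.

Lemma normrE (z : R[i]) : `|z| = (normc z)%:C.
Proof. by []. Qed.

Lemma normc_real (x : R) : normc x%:C = `|x|.
Proof. by rewrite /= expr0n /= addr0 sqrtr_sqr. Qed.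

Lemma Re_le_normc (z : R[i]) : `|complex.Re z| <= normc z.
Proof. by rewrite -lecR; exact: normc_ge_Re. Qed.

Lemma Im_le_normc (z : R[i]) : `|complex.Im z| <= normc z.
Proof.
by case: z => a b /=; rewrite -sqrtr_sqr ler_wsqrtr// lerDr sqr_ge0.
Qed.

Lemma cvg_normc (T : Type) (F : set_system T) {FF : Filter F}
    (f : T -> R[i]) (l : R[i]) :
  (f : T -> R[i]^o) @ F --> (l : R[i]^o) ->
  (fun t => normc (f t)) @ F --> (normc l : R^o).
Proof.
move=> fl; apply/cvgrPdist_lt => e e0.
have ec0 : 0 < e%:C by rewrite ltcR.
move/cvgrPdist_lt: fl => /(_ _ ec0); apply: filterS => t.
rewrite normrE ltcR; apply: le_lt_trans.
rewrite -lecR -normc_real -normrE rmorphB.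
exact: (@ler_dist_dist _ R[i] l (f t)).
Qed.

(** Bounded finite partial sums in R, instead of a finite extended-real
supremum: the estimates below all produce explicit bounds. *)
Definition abs_summable T (z : T -> R[i]) :=
  exists M : R, forall F : {fset T}, \sum_(i <- F) normc (z i) <= M.

Lemma abs_summableP T (z : T -> R[i]) :
  (\esum_(i in [set: T]) (normc (z i))%:E < +oo)%E <-> abs_summable z.
Proof.
split=> [zoo|[M zM]]; last first.
  apply: le_lt_trans (ltry M); apply: ge_ereal_sup => _ [A [finA _] <-].
  by rewrite fsbig_finite//= sumEFin lee_fin.
have z0 : (0 <= \esum_(i in [set: T]) (normc (z i))%:E)%E.
  by apply: esum_ge0 => i _; rewrite lee_fin normc_ge0.
exists (fine (\esum_(i in [set: T]) (normc (z i))%:E)) => F.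
rewrite -lee_fin fineK ?ge0_fin_numE//; apply: esum_ge; exists [set` F] => //.
by rewrite fsbig_finite//= set_fsetK sumEFin.
Qed.

Lemma abs_summable_le T (w z : T -> R[i]) :
  (forall i, normc (w i) <= normc (z i)) -> abs_summable z -> abs_summable w.
Proof.
move=> wz [M zM]; exists M => F; apply: le_trans (zM F).
by apply: ler_sum => i _.
Qed.

Lemma abs_summableB T (z w : T -> R[i]) :
  abs_summable z -> abs_summable w -> abs_summable (fun i => z i - w i).
Proof.
move=> [M zM] [N wN]; exists (M + N) => F.
apply: le_trans (lerD (zM F) (wN F)); rewrite -big_split /=.
apply: ler_sum => i _; rewrite -[X in _ <= _ + X](normcN (w i)).
exact: le_normcD.
Qed.

Lemma abs_summable_mul S T (a : S -> R[i]) (b : T -> R[i]) :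
  abs_summable a -> abs_summable b ->
  abs_summable (fun k : S * T => a k.1 * b k.2).
Proof.
move=> [M aM] [N bN]; exists (M * N) => F.
have N0 : 0 <= N by have := bN fset0; rewrite big_nil.
rewrite (partition_big_imfset _ fst) /=.
apply: (@le_trans _ _ (\sum_(p <- (fst @` F)%fset) normc (a p) * N)); last first.
  by rewrite -mulr_suml ler_wpM2r.
apply: ler_sum => p _.
under eq_bigr do rewrite ComplexField.Normc.normcM.
pose G := (snd @` [fset k in F | k.1 == p])%fset.
have -> : \sum_(k <- F | k.1 == p) normc (a k.1) * normc (b k.2) =
    normc (a p) * \sum_(q <- G) normc (b q).
  (* on the fiber over p the second projection is injective *)
  rewrite big_imfset /= ?big_fset ?mulr_sumr/=.
    by apply: eq_bigr => k /eqP ->.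
  by move=> -[a1 a2] [b1 b2]; rewrite !inE /= => /andP[_ /eqP->] /andP[_ /eqP->] ->.
by apply: ler_wpM2l => //; exact: normc_ge0.
Qed.

(** For finite G, the sum of |t i| over G is a limit of sums of moduli of
partial fiber sums.  By the triangle inequality these are bounded by partial
sums of |z|, because distinct fibers are disjoint. *)
Lemma abs_summable_fiberwise S T (f : S -> T) (z : S -> R[i]) (t : T -> R[i]) :
  abs_summable z ->
  (forall i, sums_to (fun k => if f k == i then z k else 0) (t i)) ->
  abs_summable t.
Proof.
move=> [M zM] zt; exists M => G.
have tG : (fun H : {fset S} =>
    \sum_(i <- G) normc (\sum_(k <- H) (if f k == i then z k else 0))) @ totally
    --> (\sum_(i <- G) normc (t i) : R^o).
  apply: (@cvg_big R^o _ _ _ _ (@add_continuous R^o)) => i _.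
  apply: cvg_normc.
  by have := zt i; rewrite /sums_to; under eq_cvg do rewrite partial_sumE.
apply: (cvgr_to_le tG); apply: nearW => H; apply: le_trans (zM H).
have normc_sum i : normc (\sum_(k <- H) (if f k == i then z k else 0)) <=
    \sum_(k <- H) if f k == i then normc (z k) else 0.
  rewrite -lecR -normrE; apply: le_trans (ler_norm_sum _ _ _) _.
  rewrite rmorph_sum; apply: ler_sum => k _.
  by case: ifP => _; rewrite ?normr0.
apply: le_trans (ler_sum _ (fun i _ => normc_sum i)) _.
rewrite exchange_big /=; apply: ler_sum => k _; rewrite -big_mkcond /=.
under eq_bigl do rewrite eq_sym.
by rewrite sumr_fset_pred1; case: ifP; rewrite ?normc_ge0.
Qed.

Lemma ler_sum_fset T (r : T -> R) (F G : {fset T}) :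
  (forall i, 0 <= r i) -> (F `<=` G)%fset ->
  \sum_(i <- F) r i <= \sum_(i <- G) r i.
Proof.
move=> r0 FG; rewrite [leRHS](bigID (mem F)) /=.
have FE : [fset i in G | i \in F]%fset = F.
  apply/fsetP => i; rewrite !inE /= andbC.
  by case: (boolP (i \in F)) => // /(fsubsetP FG).
by rewrite -{1}FE big_fset /= lerDl sumr_ge0.
Qed.

Lemma sums_to_nonneg T (r : T -> R) (M : R) :
  (forall i, 0 <= r i) -> (forall F : {fset T}, \sum_(i <- F) r i <= M) ->
  exists s : R, sums_to (fun i => (r i)%:C) s%:C.
Proof.
move=> r0 rM.
pose E := [set \sum_(i <- F) r i | F in [set: {fset T}]].
have supE : has_sup E.
  split; first by exists (\sum_(i <- fset0) r i); exists fset0.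
  by exists M => _ [F _ <-].
exists (sup E); apply/cvgrPdist_lt => -[e i]; rewrite ltcE /= => /andP[/eqP -> e0].
have [_ [F _ <-] eF] := sup_adherent e0 supE.
apply: filterS (totally_superset F) => G FG.
rewrite partial_sumE -rmorph_sum -rmorphB ger0_norm ?ler0c ?ltcR.
  by rewrite ltrBlDr -ltrBlDl; apply: lt_le_trans eF (ler_sum_fset r0 FG).
by rewrite subr_ge0; apply: sup_upper_bound => //; exists G.
Qed.

(** Completeness is only used through suprema of bounded nonnegative families:
a real family x with |x| <= |z| is the difference (x + |z|) - |z| of two of
them, and z itself is a combination of its real and imaginary parts. *)
Lemma abs_summable_sums_to T (z : T -> R[i]) :
  abs_summable z -> exists s, sums_to z s.
Proof.
move=> [M zM].
have real_sum (x : T -> R) : (forall i, `|x i| <= normc (z i)) ->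
    exists s : R[i], sums_to (fun i => (x i)%:C) s.
  move=> xz.
  have [i||t tP] := @sums_to_nonneg _ (fun i => x i + normc (z i)) (M + M).
  - by have := xz i; rewrite ler_norml -subr_ge0 opprK => /andP[].
  - move=> F; rewrite big_split; apply: lerD => //=; apply: le_trans (zM F).
    by apply: ler_sum => i _; apply: le_trans (xz i); exact: ler_norm.
  have [u uP] := sums_to_nonneg (fun i => normc_ge0 (z i)) zM.
  exists (t%:C - u%:C); have := sums_toB tP uP; congr sums_to.
  by apply/funext => i; rewrite -rmorphB addrK.
have [s sP] := real_sum _ (fun i => Re_le_normc (z i)).
have [t tP] := real_sum _ (fun i => Im_le_normc (z i)).
exists (s - (- 'i) * t); have := sums_toB sP (sums_toMl (c := - 'i) tP).
by congr sums_to; apply/funext => i; rewrite mulNr opprK -complexE.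
Qed.

End AbsoluteSums.

(** * Rational Wiener algebras *)

Section WienerAlgebra.
Context {R : realType}.
Implicit Types (D : set rat) (f g : solenoid R -> R[i]).
Local Notation normc := (@ComplexField.Normc.normc R).

Lemma chi_norm (q : rat) (u : solenoid R) : `|chi q u| = 1.
Proof.
have norm1 (x : R[i]) (k : int) : `|x| = 1 -> `|x ^ k| = 1.
  move=> x1; case: k => n; first by rewrite -exprnP normrX x1 expr1n.
  by rewrite NegzE -exprnN normrV ?normrX ?x1 ?expr1n ?invr1// unitfE
    expf_neq0// -normr_eq0 x1 oner_eq0.
exact/norm1/sproj_circle.
Qed.

Lemma normc_chi (z : R[i]) q (u : solenoid R) : normc (z * chi q u) = normc z.
Proof.
have [chi1] := chi_norm q u.
by rewrite ComplexField.Normc.normcM chi1 mulr1.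
Qed.

Lemma chi0 : @chi R 0 = 1.
Proof. by apply/funext => u; rewrite /chi (_ : numq 0 = 0)// expr0z. Qed.

(** Over the product N of the two denominators, both p and q are fractions with
denominator N, so the identity is the law of exponents for the projection to
level N. *)
Lemma chiD (p q : rat) (u : solenoid R) : chi (p + q) u = chi p u * chi q u.
Proof.
have NP : (0 < val (den_level p) * val (den_level q))%N.
  by rewrite muln_gt0; apply/andP; split; exact: valP.
pose N : level := exist (fun m : nat => (0 < m)%N) _ NP.
have denE (r : rat) : (`|denq r|%N)%:Q = (denq r)%:Q by rewrite absz_denq.
have d0 (r : rat) : (denq r)%:Q != 0 by rewrite intr_eq0 denq_neq0.
have NE : (val N)%:Q = (denq p)%:Q * (denq q)%:Q.
  by rewrite /= PoszM intrM !denE.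
have pE : p = (numq p * denq q)%:Q / (val N)%:Q.
  by rewrite NE intrM -mulf_div divff// mulr1 divq_num_den.
have qE : q = (denq p * numq q)%:Q / (val N)%:Q.
  by rewrite NE intrM -mulf_div divff// mul1r divq_num_den.
have uN : sproj u N \is a GRing.unit.
  by rewrite unitfE -normr_eq0 sproj_circle oner_eq0.
rewrite pE qE -mulrDl -intrD !chi_frac.
by rewrite expfzDr -?unitfE.
Qed.

Lemma chi_mulN (q : rat) : @chi R q * chi (- q) = 1.
Proof. by apply/funext => u; rewrite /= -chi0 -(subrr q) chiD. Qed.

Lemma wiener_onP D f : wiener_on D f <-> exists a : rat -> R[i],
  [/\ abs_summable a, forall q, ~ D q -> a q = 0
    & forall u, sums_to (fun q => a q * chi q u) (f u)].
Proof.
by split=> -[a [sa Da af]]; exists a; split=> //; exact/abs_summableP.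
Qed.

Lemma wiener_on_sub D E : D `<=` E -> @wiener_on R D `<=` wiener_on E.
Proof.
move=> DE f [a [sa Da af]]; exists a; split=> // q nEq; apply: Da.
by move/DE.
Qed.

Lemma wiener_onB D f g :
  wiener_on D f -> wiener_on D g -> wiener_on D (f - g).
Proof.
move=> /wiener_onP[a [sa Da af]] /wiener_onP[b [sb Db bg]].
apply/wiener_onP; exists (fun q => a q - b q); split.
- exact: abs_summableB.
- by move=> q nDq; rewrite Da// Db// subrr.
- move=> u; have := sums_toB (af u) (bg u); congr sums_to.
  by apply/funext => q; rewrite mulrBl.
Qed.

(** The coefficient of chi_r in the product is the unordered sum of a_p b_q over
p + q = r.  Tracking supports covers at once closure of the three algebras under
products and the effect of multiplying by a single character. *)
Lemma wiener_onM D E G f g :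
  (forall p q, D p -> E q -> G (p + q)) ->
  wiener_on D f -> wiener_on E g -> wiener_on G (f * g).
Proof.
move=> DEG /wiener_onP[a [sa Da af]] /wiener_onP[b [sb Eb bg]].
pose ab (k : rat * rat) := a k.1 * b k.2.
pose deg (k : rat * rat) := k.1 + k.2.
have sab : abs_summable ab := abs_summable_mul sa sb.
have /choice[c cP] r : exists s, sums_to (fun k => if deg k == r then ab k else 0) s.
  apply: abs_summable_sums_to; apply: abs_summable_le sab => k.
  by case: ifP => // _; rewrite ComplexField.Normc.normc0 normc_ge0.
apply/wiener_onP; exists c; split.
- exact: abs_summable_fiberwise sab cP.
- move=> r nGr; apply: sums_to_unique (cP r) _.
  have := @sums_to0 R[i] (rat * rat)%type; congr sums_to.
  apply/funext => -[p q]; rewrite /ab; case: eqP => //= pqr.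
  have [Dp|/Da->] := pselect (D p); last by rewrite mul0r.
  have [Eq|/Eb->] := pselect (E q); last by rewrite mulr0.
  by case: nGr; rewrite -pqr; exact: DEG.
- move=> u.
  have [s sP] : exists s, sums_to (fun k => ab k * chi (deg k) u) s.
    apply: abs_summable_sums_to; apply: abs_summable_le sab => k.
    by rewrite normc_chi.
  have -> : (f * g) u = s.
    apply/esym/(sums_to_mul (af u) (bg u)); move: sP; congr sums_to.
    by apply/funext => k; rewrite /ab chiD mulrACA.
  apply: (sums_to_fiberwise (f := deg)) sP _ => r.
  have := sums_toMr (c := chi r u) (cP r); congr sums_to.
  by apply/funext => k; case: eqP => [->|]//; rewrite mul0r.
Qed.

Lemma wiener_on_chi (p : rat) : wiener_on [set p] (@chi R p).
Proof.
apply/wiener_onP; exists (fun q => if q == p then 1 else 0); split.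
- exists 1 => F.
  rewrite (eq_bigr (fun q => if q == p then 1 else 0)) => [|q _]; last first.
    by case: ifP; rewrite ?ComplexField.Normc.normc1 ?ComplexField.Normc.normc0.
  by rewrite -big_mkcond /= sumr_fset_pred1; case: ifP.
- by move=> q; case: eqP.
- move=> u; have := @sums_to_single R[i] _ p (chi p u); congr sums_to.
  by apply/funext => q; case: eqP => [->|]; rewrite ?mul1r ?mul0r.
Qed.

Lemma wiener_on_subring D :
  D 0 -> (forall p q, D p -> D q -> D (p + q)) -> subring_set (@wiener_on R D).
Proof.
move=> D0 DD; split; last by move=> f g; exact: wiener_onM.
  by rewrite -chi0; apply: wiener_on_sub (wiener_on_chi 0) => q ->.
by move=> f g; exact: wiener_onB.
Qed.

Lemma wiener_on_split D E f :
  wiener_on D f -> exists g h,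
    [/\ wiener_on (D `&` E) g, wiener_on (D `\` E) h & f = g + h].
Proof.
move=> /wiener_onP[a [sa Da af]].
pose b q := if `[< E q >] then a q else 0.
have ba q : normc (b q) <= normc (a q).
  by rewrite /b; case: ifP => // _; rewrite ComplexField.Normc.normc0 normc_ge0.
have sb : abs_summable b := abs_summable_le ba sa.
have /choice[g gP] (u : solenoid R) : exists s, sums_to (fun q => b q * chi q u) s.
  by apply: abs_summable_sums_to; apply: abs_summable_le sb => q; rewrite normc_chi.
exists g, (f - g); split; last by rewrite addrC subrK.
- apply/wiener_onP; exists b; split=> // q nDEq; rewrite /b.
  by case: asboolP => // Eq; apply: Da => Dq; exact: nDEq.
- apply/wiener_onP; exists (fun q => a q - b q); split.
  + exact: abs_summableB.
  + move=> q nDEq; rewrite /b; case: asboolP => [_|nEq]; first by rewrite subrr.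
    by rewrite subr0; apply: Da => Dq; exact: nDEq.
  + move=> u; have := sums_toB (af u) (gP u); congr sums_to.
    by apply/funext => q; rewrite mulrBl.
Qed.

(** Cut f at frequency p: after division by chi_p the upper part has
frequencies >= 0, and after division by chi_q the lower part has frequencies
< p - q <= 0. *)
Lemma wiener_split (p q : rat) f : p <= q -> wiener f ->
  exists x y, [/\ wiener_plus x, wiener_minus y & f = chi p * x + y * chi q].
Proof.
move=> pq /(@wiener_on_split _ [set r | p <= r])[g [h [Wg Wh ->]]].
exists (chi (- p) * g), (h * chi (- q)); split.
- apply: wiener_onM (wiener_on_chi (- p)) Wg => _ r -> [_ /= pr].
  by rewrite addrC subr_ge0.
- apply: wiener_onM Wh (wiener_on_chi (- q)) => r _ [_ /= npr] ->.
  by rewrite subr_le0; apply: le_trans pq; rewrite ltW// ltNge; exact/negP.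
- by rewrite mulrA chi_mulN mul1r -mulrA [chi (- q) * _]mulrC chi_mulN mulr1.
Qed.

End WienerAlgebra.

Theorem proposition6 (R : realType) (n : nat)
    (A : 'M[solenoid R -> R[i]]_n) (q : 'I_n -> rat)
    (hA : GL_of (@wiener R) A)
    (hq : forall j : 'I_n, has_wiener_index (A j j) (q j)) :
  (is_trig_mx A^T ->
   (forall i j : 'I_n, (i <= j)%N -> q i <= q j) ->
   diag_factorization A q) /\
  (is_trig_mx A ->
   (forall i j : 'I_n, (i <= j)%N -> q j <= q i) ->
   diag_factorization A q).
Proof.
have ringW : subring_set (@wiener R) by apply: wiener_on_subring.
have ringWm : subring_set (@wiener_minus R).
  by apply: wiener_on_subring => //= p r p0 r0; rewrite -[leRHS]addr0 lerD.
have ringWp : subring_set (@wiener_plus R).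
  by apply: wiener_on_subring => //= p r; exact: addr_ge0.
have WmW : @wiener_minus R `<=` @wiener R by exact: wiener_on_sub.
have WpW : @wiener_plus R `<=` @wiener R by exact: wiener_on_sub.
have [WA _] := hA.
split=> trigA le_q.
  apply: (upper_factorization ringW ringWm ringWp) => // i j ij g.
  by apply: wiener_split; exact: le_q.
apply: (lower_factorization ringW ringWm ringWp) => // i j ij g.
by apply: wiener_split; exact: le_q.
Qed.
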